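(* Let $\Omega=[\alpha,\beta]\subset\mathbb{R}$ be a compact interval with $\alpha<\beta$, let $p_1,\dots,p_n\in(\alpha,\beta)$, and let $k_1,k_2,k_3,\dots\in\{1,\dots,n\}$ be a sequence in which every value $1,\dots,n$ occurs infinitely many times. Define the relaxation $$F_m=G_{p_{k_m}}G_{p_{k_{m-1}}}\cdots G_{p_{k_1}}0_\Omega,\qquad m\ge 1.$$ Then the sequence $(F_m)$ stabilizes: there exists $m_0$ such that $F_m=F_{m_0}$ for all $m\ge m_0$.
   Context: Let $\Omega=[\alpha,\beta]$ be a compact interval with $\alpha<\beta$ and $\Omega^\circ=(\alpha,\beta)$. An $\Omega$-tropical series is a function $F:\Omega\to[0,\infty)$ with $F(\alpha)=F(\beta)=0$ that can be written as $F(z)=\inf_{v\in\mathbb{Z}}(a_v+zv)$ for some real numbers $a_v$. Its canonical coefficients are the smallest possible such coefficients, namely $a_v=\sup_{z\in\Omega}(F(z)-zv)$. The function $0_\Omega$ is the $\Omega$-tropical series identically equal to $0$ on $\Omega$. For $p\in\Omega^\circ$ the operator $G_p$ on $\Omega$-tropical series is defined as follows: if $F$ is not differentiable at $p$, then $G_pF=F$; otherwise there is a unique $w\in\mathbb{Z}$ with $F(z)=a_w+zw$ for $z$ in a neighbourhood of $p$ (where $a_v$ are the canonical coefficients of $F$), and $G_pF(z)=\inf_{v\in\mathbb{Z}}(b_v+zv)$ for $z\in\Omega$, where $b_v=a_v$ for $v\neq w$ and $b_w=\min_{v\in\mathbb{Z}\setminus\{w\}}(a_v+pv)-pw$. *)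

(* Defs.v *)
From HB Require Import structures.
From mathcomp Require Import all_boot all_order all_algebra.
From mathcomp Require Import all_classical all_reals all_analysis.
Set Implicit Arguments. Unset Strict Implicit. Unset Printing Implicit Defensive.
Import Order.TTheory GRing.Theory Num.Theory.
Import numFieldNormedType.Exports.
Local Open Scope classical_set_scope.
Local Open Scope ring_scope.

(* Omega-tropical series are represented as functions R -> R; only their
   values on Omega = [alpha, beta] matter. *)

Definition trop_series {R : realType} (alpha beta : R) (F : R -> R) : Prop :=
  (forall z, z \in `[alpha, beta] -> 0 <= F z) /\ F alpha = 0 /\ F beta = 0 /\
  exists a : int -> R, forall z, z \in `[alpha, beta] ->
    F z = inf [set a v + z * v%:~R | v in [set: int]].

Definition can_coef {R : realType} (alpha beta : R) (F : R -> R) (v : int) : R :=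
  sup [set F z - z * v%:~R | z in `[alpha, beta]].

Definition zero_series {R : realType} : R -> R := fun _ => 0.

Definition Gop {R : realType} (alpha beta p : R) (F : R -> R) : R -> R :=
  if `[< derivable F p 1 >] then
    let a := can_coef alpha beta F in
    (* the unique w with F z = a_w + z w for z near p *)
    let w := xget 0 [set w : int | \forall z \near p, F z = a w + z * w%:~R] in
    let b := fun v : int =>
      if v == w then inf [set a u + p * u%:~R | u in [set u : int | u != w]] - p * w%:~R
      else a v in
    fun z => inf [set b v + z * v%:~R | v in [set: int]]
  else F.

Fixpoint relax {R : realType} (alpha beta : R) (n : nat) (p : 'I_n -> R)
    (k : nat -> 'I_n) (m : nat) : R -> R :=
  match m with
  | O => zero_series
  | S m' => Gop alpha beta (p (k m')) (relax alpha beta p k m')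
  end.

(* Main.v *)
Require Import Defs.
From HB Require Import structures.
From mathcomp Require Import all_boot all_order all_algebra.
From mathcomp Require Import all_classical all_reals all_analysis.
From mathcomp Require Import lra zify ring.
Import Order.TTheory GRing.Theory Num.Theory.
Import numFieldNormedType.Exports.
Local Open Scope classical_set_scope.
Local Open Scope ring_scope.
Set Implicit Arguments. Unset Strict Implicit. Unset Printing Implicit Defensive.

(** Encode a tropical series with canonical coefficients [a] by its kinks
    [x_v = a_(v-1) - a_v], a nonincreasing family of particles in
    [[alpha, beta]], almost all of them sitting at an endpoint. If [p] lies
    strictly between the neighbouring particles [x_(w+1)] and [x_w], then
    [G_p] moves both towards [p] at equal speed until the first one reaches it;
    if [p] carries a particle, [G_p] is the identity.

    The coefficients increase along the relaxation and stay below those of a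
    sum of tents with one kink at each [p_i]. Hence only finitely many
    particles ever move, and each of them converges. Late in the process a move
    at [p] must involve a particle with limit [p], so that, in terms of the
    deviations ("charges") of the particles from their limits, opposite charges
    cancel, a negative charge moves one particle to the right, or a positive one
    moves one particle to the left. Weighting a charge by the number of
    particles ahead of it gives a natural number that strictly decreases at
    every move, so there are finitely many moves. *)

(** * Kinks and toppling *)

Definition kink {R : realType} (a : int -> R) (v : int) : R := a (v - 1) - a v.

Definition trop {R : realType} (a : int -> R) (z : R) : R :=
  inf [set a v + z * v%:~R | v in [set: int]].

Definition kinks_sorted {R : realType} (a : int -> R) :=
  forall v, kink a (v + 1) <= kink a v.

(** For large [|v|] the line of slope [v] passes through [(alpha, 0)] or [(beta, 0)], so all but
    finitely many kinks sit at an endpoint. *)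
Definition tame {R : realType} (alpha beta : R) (a : int -> R) :=
  kinks_sorted a /\ exists N : nat,
  (forall v : int, N%:Z <= v -> a v = - alpha * v%:~R) /\
  (forall v : int, v <= - N%:Z -> a v = - beta * v%:~R).

(** Raising [a w] by [c] moves [kink a w] left and [kink a (w + 1)] right by [c]; the minimum stops
    the move when the nearer kink reaches [P]. *)
Definition topple {R : realType} (P : R) (a b : int -> R) :=
  exists w : int, kink a (w + 1) < P < kink a w /\
    forall v, b v = a v +
      (if v == w then Num.min (P - kink a (w + 1)) (kink a w - P) else 0).

Lemma inf_min {R : realType} (I : Type) (A : set I) (f : I -> R) (i : I) :
  A i -> (forall j, A j -> f i <= f j) -> inf [set f j | j in A] = f i.
Proof.
move=> Ai min_i; apply/eqP; rewrite eq_le; apply/andP; split.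
  apply: ge_inf; last by exists i.
  by exists (f i) => _ [j Aj <-]; exact: min_i.
apply: lb_le_inf; first by exists (f i), i.
by move=> _ [j Aj <-]; exact: min_i.
Qed.

Lemma sup_max {R : realType} (I : Type) (A : set I) (f : I -> R) (i : I) :
  A i -> (forall j, A j -> f j <= f i) -> sup [set f j | j in A] = f i.
Proof.
move=> Ai max_i; apply/eqP; rewrite eq_le; apply/andP; split.
  apply: ge_sup; first by exists (f i), i.
  by move=> _ [j Aj <-]; exact: max_i.
apply: ub_le_sup; last by exists i.
by exists (f i) => _ [j Aj <-]; exact: max_i.
Qed.

Lemma kinks_sorted_addn {R : realType} (a : int -> R) (v : int) (k : nat) :
  kinks_sorted a -> kink a (v + k%:Z) <= kink a v.
Proof.
move=> sa; elim: k => [|k IH]; first by rewrite addr0.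
by rewrite -addn1 PoszD addrA (le_trans (sa _)).
Qed.

(** The increment of [a u + z * u] from [u - 1] to [u] is [z - kink a u], which by sortedness is
    nonpositive up to [v] and nonnegative after it. *)
Lemma trop_active_le {R : realType} (a : int -> R) (v u : int) (z : R) :
  kinks_sorted a -> kink a (v + 1) <= z <= kink a v ->
  a v + z * v%:~R <= a u + z * u%:~R.
Proof.
move=> sa /andP[lo hi].
have [le_vu|/ltW le_uv] := leP v u.
  have [k ->] : exists k : nat, u = v + k%:Z by exists `|u - v|%N; lia.
  elim: k => [|k IH]; first by rewrite addr0.
  apply: (le_trans IH).
  have := kinks_sorted_addn (v + 1) k sa; rewrite /kink.
  have -> : v + 1 + k%:Z - 1 = v + k%:Z by lia.
  have -> : v + 1 + k%:Z = v + k.+1%:Z by lia.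
  move: lo; rewrite /kink => lo sk.
  have -> : (v + k.+1%:Z)%:~R = (v + k%:Z)%:~R + 1 :> R.
    by rewrite -[1]/(1%:~R) -rmorphD /=; congr _%:~R; lia.
  rewrite mulrDr mulr1; lra.
have [k ->] : exists k : nat, u = v - k%:Z by exists `|v - u|%N; lia.
elim: k => [|k IH]; first by rewrite subr0.
apply: (le_trans IH).
have := kinks_sorted_addn (v - k%:Z) k sa; rewrite subrK /kink => sk.
move: hi; rewrite /kink => hi.
have -> : v - k.+1%:Z = v - k%:Z - 1 by lia.
have -> : (v - k%:Z - 1)%:~R = (v - k%:Z)%:~R - 1 :> R by rewrite rmorphB.
rewrite mulrBr mulr1; lra.
Qed.

Lemma trop_active {R : realType} (a : int -> R) (v : int) (z : R) :
  kinks_sorted a -> kink a (v + 1) <= z <= kink a v ->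
  trop a z = a v + z * v%:~R.
Proof.
move=> sa hz; apply: (@inf_min _ _ setT (fun v : int => a v + z * v%:~R)) => // u _.
exact: trop_active_le.
Qed.

(** * Tame families as canonical coefficients *)

Section tame.
Context {R : realType} (alpha beta : R) (a : int -> R).
Hypothesis ta : tame alpha beta a.

Lemma tame_kink_left : exists N : nat, forall v : int, N%:Z < v -> kink a v = alpha.
Proof.
case: ta => _ [N [aN _]]; exists N => v Nv; rewrite /kink !aN; [|lia..].
rewrite rmorphB /=; ring.
Qed.

Lemma tame_kink_right : exists N : nat, forall v : int, v <= - N%:Z -> kink a v = beta.
Proof.
case: ta => _ [N [_ aN]]; exists N => v Nv; rewrite /kink !aN; [|lia..].
rewrite rmorphB /=; ring.
Qed.

Lemma tame_kink_itv v : alpha <= kink a v <= beta.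
Proof.
have [sa _] := ta; apply/andP; split.
  have [N hN] := tame_kink_left.
  rewrite -(hN (v + (`|v| + N).+1%:Z)); first exact: kinks_sorted_addn.
  lia.
have [N hN] := tame_kink_right.
rewrite -(hN (v - (`|v| + N)%:Z)); last lia.
rewrite -{1}(subrK (`|v| + N)%:Z v); exact: kinks_sorted_addn.
Qed.

Lemma tame_active z : alpha <= z <= beta -> exists v, kink a (v + 1) <= z <= kink a v.
Proof.
move=> /andP[az zb].
have [N hN] := tame_kink_left; have [N' hN'] := tame_kink_right.
pose v0 : int := - N'%:Z.
have ex : exists k : nat, kink a (v0 + k%:Z + 1) <= z.
  by exists (N' + N)%N; rewrite hN // /v0; lia.
(* The first kink at or below [z], searching from an index whose kink is [beta]; the kink before it
   is then at or above [z]. *)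
case: (ex_minnP ex) => k hk kmin; exists (v0 + k%:Z); rewrite hk /=.
case: k kmin {hk} => [|k] kmin; first by rewrite addr0 hN' /v0 //; lia.
rewrite leNgt; apply/negP => h; have := kmin k.
rewrite (_ : v0 + k%:Z + 1 = v0 + k.+1%:Z); last lia.
by move=> /(_ (ltW h)); lia.
Qed.

Lemma trop_le z v : alpha <= z <= beta -> trop a z <= a v + z * v%:~R.
Proof.
case: ta => sa _ /tame_active [u hu].
by rewrite (trop_active sa hu); exact: trop_active_le.
Qed.

(** The supremum is attained at [z = kink a v], where the line of slope [v] is active. *)
Lemma can_coef_trop F : (forall z, z \in `[alpha, beta] -> F z = trop a z) ->
  can_coef alpha beta F = a.
Proof.
move=> Fa; apply/funext => v; rewrite /can_coef.
have [sa _] := ta.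
have hv := tame_kink_itv v.
have vin : kink a v \in `[alpha, beta] by rewrite in_itv.
have ev : F (kink a v) - kink a v * v%:~R = a v.
  by rewrite Fa // (@trop_active _ _ v) ?lexx ?andbT //; lra.
rewrite -[RHS]ev.
apply: (@sup_max _ _ [set` `[alpha, beta]] (fun z => F z - z * v%:~R)) => //= z zin.
rewrite ev Fa // lerBlDr; apply: trop_le.
by move: zin; rewrite in_itv.
Qed.

End tame.

(** * Differentiability and kinks *)

Lemma support_slope_le {R : realType} (F : R -> R) (P c1 c2 : R) :
  (\forall z \near P, F z <= F P + c1 * (z - P)) ->
  (\forall z \near P, F z <= F P + c2 * (z - P)) ->
  derivable F P 1 -> c2 <= c1.
Proof.
move=> sup1 sup2; rewrite /derivable => cF.
have shift_near c : (\forall z \near P, F z <= F P + c * (z - P)) ->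
    \forall h \near (0 : R), F (h *: 1 + P) - F P <= c * h.
  rewrite (near_shift 0) => near_sup.
  near=> h; have : F (h + P) <= F P + c * (h + P - P).
    by near: h; apply: filterS near_sup => h; rewrite /= subr0.
  by rewrite addrK lerBlDl [_ *: _]mulr1.
set q := (X in cvg (X @ _)) in cF.
(* Difference quotients are at least [c2] on the left of [P] and at most [c1] on the right, and both
   sides share one limit. *)
apply: (@le_trans _ _ (lim (q @ 0^'))).
  rewrite -(cvg_lim _ (cvg_dnbhs_at_left cF)) //.
  apply: limr_ge; first by apply: cvgP (cvg_dnbhs_at_left cF).
  near=> h; have h0 : h < 0 by [].
  rewrite /q /= [_ *: _]mulrC ler_ndivlMr //.
  near: h; apply: cvg_within; exact: shift_near.
rewrite -(cvg_lim _ (cvg_dnbhs_at_right cF)) //.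
apply: limr_le; first by apply: cvgP (cvg_dnbhs_at_right cF).
near=> h; have h0 : 0 < h by [].
rewrite /q /= [_ *: _]mulrC ler_pdivrMr //.
near: h; apply: cvg_within; exact: shift_near.
Unshelve. all: by end_near.
Qed.

(** The lines of slopes [v - 1] and [v] both touch [F] from above at the kink, which would force
    [v <= v - 1]. *)
Lemma not_derivable_kink {R : realType} (alpha beta : R) (a : int -> R) (F : R -> R) (v : int) :
  tame alpha beta a ->
  (forall z, z \in `[alpha, beta] -> F z = trop a z) ->
  alpha < kink a v < beta -> ~ derivable F (kink a v) 1.
Proof.
move=> ta Fa /andP[aP Pb]; have [sa _] := ta.
pose P := kink a v.
have near_in : \forall z \near P, z \in `[alpha, beta].
  near=> z; rewrite in_itv /=; apply/andP; split; apply/ltW; near: z.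
    exact: lt_nbhsr.
  exact: lt_nbhsl.
have Pin : P \in `[alpha, beta] by rewrite in_itv /= !ltW.
have FP : F P = a v + P * v%:~R.
  by rewrite Fa // (@trop_active _ _ v) // lexx sa.
have FP1 : F P = a (v - 1) + P * (v - 1)%:~R.
  by rewrite FP rmorphB /= /P /kink; ring.
have sup u : F P = a u + P * u%:~R -> \forall z \near P, F z <= F P + u%:~R * (z - P).
  move=> FPu; apply: filterS near_in => z zin; rewrite FPu Fa //.
  rewrite (_ : _ + _ * _ = a u + z * u%:~R); last by ring.
  by apply: (trop_le ta); move: zin; rewrite in_itv.
move=> dF; have := support_slope_le (sup _ FP1) (sup _ FP) dF.
by rewrite ler_int; lia.
Unshelve. all: by end_near.
Qed.

Lemma near_trop_linear {R : realType} (alpha beta : R) (a : int -> R) (F : R -> R) (w : int) (P : R) :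
  tame alpha beta a ->
  (forall z, z \in `[alpha, beta] -> F z = trop a z) ->
  alpha < P < beta -> kink a (w + 1) < P < kink a w ->
  \forall z \near P, F z = a w + z * w%:~R.
Proof.
move=> ta Fa /andP[aP Pb] /andP[wP Pw]; have [sa _] := ta.
near=> z; rewrite Fa.
  by apply: trop_active => //; apply/andP; split; apply/ltW; near: z;
    [exact: lt_nbhsr|exact: lt_nbhsl].
by rewrite in_itv /=; apply/andP; split; apply/ltW; near: z;
    [exact: lt_nbhsr|exact: lt_nbhsl].
Unshelve. all: by end_near.
Qed.

Lemma near_linear_inj {R : realType} (P x y : R) (u w : int) :
  (\forall z \near P, x + z * u%:~R = y + z * w%:~R) -> u = w.
Proof.
move=> H; apply/eqP; rewrite -(eqr_int R); apply/eqP.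
have H0 := nbhs_singleton H.
have Hr : \forall z \near P^'+, x + z * u%:~R = y + z * w%:~R by exact: cvg_within.
have [z [/= Hz Pz]] := filter_ex (filterI Hr (nbhs_right_gt P)).
have : (z - P) * (u%:~R - w%:~R) = 0 by rewrite mulrBl !mulrBr; lra.
move/eqP; rewrite mulf_eq0 subr_eq0 (gt_eqF Pz) /= subr_eq0 => /eqP //.
Qed.

(** * [Gop] as toppling *)

Lemma topple_sorted {R : realType} (P : R) (a b : int -> R) :
  kinks_sorted a -> topple P a b -> kinks_sorted b.
Proof.
move=> sa [w [/andP[wP Pw] hb]] v; have := sa v.
rewrite /kink !hb addrK => sv.
(* Kinks [w] and [w + 1] approach [P] from opposite sides without passing it, and move away from
   their other neighbours. *)
have [->|vw] := eqVneq v w.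
  rewrite !ifF; [|lia..].
  move: wP Pw; rewrite /kink addrK.
  case: (leP (P - _)) => h wP Pw; lra.
have [vw1|vw1] := eqVneq (v + 1) w.
  rewrite ifF; last lia.
  subst w; move: wP Pw; rewrite /kink !addrK.
  case: (leP (P - _)) => h wP Pw; lra.
have [vw2|vw2] := eqVneq (v - 1) w.
  subst w; move: wP Pw; rewrite /kink !subrK.
  case: (leP (P - _)) => h wP Pw; lra.
lra.
Qed.

Lemma topple_tame {R : realType} (alpha beta P : R) (a b : int -> R) :
  tame alpha beta a -> topple P a b -> tame alpha beta b.
Proof.
move=> [sa [N [aN1 aN2]]] tp; split; first exact: topple_sorted tp.
case: tp => w [_ hb]; exists (N + `|w|).+1%N; split => v hv.
  by rewrite hb ifF ?addr0 ?aN1 //; lia.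
by rewrite hb ifF ?addr0 ?aN2 //; lia.
Qed.

Lemma affine_le_translate {R : realType} (x y z P s t : R) :
  0 <= (P - z) * (t - s) -> x + z * s <= y + z * t -> x + P * s <= y + P * t.
Proof. by rewrite mulrBr !mulrBl => *; lra. Qed.

(** The line of slope [w + 1] is minimal at [kink a (w + 1)], and moving right to [P] favours it
    over steeper lines. With the mirror image below, the minimum over slopes other than [w] is
    attained at [w + 1] or [w - 1]. *)
Lemma right_neighbour_le {R : realType} (a : int -> R) (w u : int) (P : R) :
  kinks_sorted a -> kink a (w + 1) < P -> w < u ->
  a (w + 1) + P * (w + 1)%:~R <= a u + P * u%:~R.
Proof.
move=> sa wP wu; apply: (@affine_le_translate _ _ _ (kink a (w + 1))).
  by rewrite mulr_ge0 // subr_ge0 ?ler_int; [exact: ltW | lia].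
by apply: trop_active_le; rewrite // sa lexx.
Qed.

Lemma left_neighbour_le {R : realType} (a : int -> R) (w u : int) (P : R) :
  kinks_sorted a -> P < kink a w -> u < w ->
  a (w - 1) + P * (w - 1)%:~R <= a u + P * u%:~R.
Proof.
move=> sa Pw uw; apply: (@affine_le_translate _ _ _ (kink a w)).
  by rewrite mulr_le0 // subr_le0 ?ler_int; [exact: ltW | lia].
by apply: trop_active_le => //; have := sa (w - 1); rewrite subrK lexx.
Qed.

Lemma right_neighbourE {R : realType} (a : int -> R) (w : int) (P : R) :
  a (w + 1) + P * (w + 1)%:~R - P * w%:~R = a w + (P - kink a (w + 1)).
Proof. by rewrite /kink addrK rmorphD /=; ring. Qed.

Lemma left_neighbourE {R : realType} (a : int -> R) (w : int) (P : R) :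
  a (w - 1) + P * (w - 1)%:~R - P * w%:~R = a w + (kink a w - P).
Proof. by rewrite /kink rmorphB /=; ring. Qed.

Lemma Gop_step {R : realType} (alpha beta P : R) (a : int -> R) (F : R -> R) :
  alpha < P < beta -> tame alpha beta a ->
  (forall z, z \in `[alpha, beta] -> F z = trop a z) ->
  exists b, [/\ tame alpha beta b, b = a \/ topple P a b &
    forall z, z \in `[alpha, beta] -> Gop alpha beta P F z = trop b z].
Proof.
move=> Pab ta Fa; have [sa _] := ta; rewrite /Gop.
case: asboolP => [dF|_]; last by exists a; split => //; left.
have [w hw] : exists w : int, kink a (w + 1) < P < kink a w.
  have [w /andP[wP Pw]] : exists w, kink a (w + 1) <= P <= kink a w.
    by apply: (tame_active ta); case/andP: Pab => *; rewrite !ltW.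
  (* Differentiability keeps [P] off every kink, so both inequalities are strict. *)
  have nk v : kink a v != P.
    by apply/eqP => kP; move: dF; rewrite -kP; apply: (not_derivable_kink ta Fa); rewrite kP.
  by exists w; rewrite !lt_neqAle wP Pw nk eq_sym nk.
rewrite (can_coef_trop ta Fa).
have near_w := near_trop_linear ta Fa Pab hw.
(* The default value of [xget] never appears: [w] satisfies the condition, and two affine functions
   agreeing near [P] have equal slopes. *)
have -> : xget 0 [set w : int | \forall z \near P, F z = a w + z * w%:~R] = w.
  apply: xget_subset1 => // u v /= Hu Hv.
  apply: (@near_linear_inj _ P (a u) (a v)).
  by apply: filterS2 Hu Hv => z -> ->.
pose b (v : int) := if v == w then inf [set a u + P * u%:~R | u in [set u : int | u != w]] - P * w%:~R
  else a v.
exists b; suff tp : topple P a b by split; [exact: topple_tame tp | right | ].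
exists w; split => // v; rewrite /b; case: eqVneq => [->|_]; last by rewrite addr0.
have [wP Pw] := andP hw.
have act_r u := @right_neighbour_le _ a w u P sa wP.
have act_l u := @left_neighbour_le _ a w u P sa Pw.
have er := right_neighbourE a w P.
have el := left_neighbourE a w P.
case: leP => h; rewrite -?er -?el; congr (_ - _).
  apply: (@inf_min _ _ [set u | u != w] (fun u : int => a u + P * u%:~R)) => /=; first lia.
  move=> u uw; have [/act_r //|uw'|eu] := ltgtP w u; last by rewrite eu eqxx in uw.
  apply: le_trans (act_l u uw'); lra.
apply: (@inf_min _ _ [set u | u != w] (fun u : int => a u + P * u%:~R)) => /=; first lia.
move=> u uw; have [uw'|/act_l //|eu] := ltgtP w u; last by rewrite eu eqxx in uw.
apply: le_trans (act_r u uw'); lra.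
Qed.

(** * A barrier for the relaxation *)

(* [B] has two minimising slopes at [P], so one of them differs from the toppled
   slope [w], and toppling raises [a_w + P w] only up to the other values. *)
Lemma topple_le_barrier {R : realType} (a b : int -> R) (P : R) (B : int -> R) (t1 t2 : int) :
  kinks_sorted a -> topple P a b -> (forall v, a v <= B v) -> t1 != t2 ->
  (forall v, B t1 + P * t1%:~R <= B v + P * v%:~R) ->
  (forall v, B t2 + P * t2%:~R <= B v + P * v%:~R) ->
  forall v, b v <= B v.
Proof.
move=> sa [w [/andP[wP Pw] hb]] aB t12 min1 min2 v; rewrite hb.
have [->|_] := eqVneq v w; last by rewrite addr0.
have [t tw mint] : exists2 t : int, t != w & B t + P * t%:~R <= B w + P * w%:~R.
  have [e|t1w] := eqVneq t1 w; last by exists t1.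
  by exists t2 => //; rewrite -e eq_sym.
have := aB t; have er := right_neighbourE a w P; have el := left_neighbourE a w P.
case: (leP (P - kink a (w + 1))) => h; have [wt|tw'|e] := ltgtP w t; try by rewrite e eqxx in tw.
- have := right_neighbour_le sa wP wt; lra.
- have := left_neighbour_le sa Pw tw'; lra.
- have := right_neighbour_le sa wP wt; lra.
- have := left_neighbour_le sa Pw tw'; lra.
Qed.

Lemma topple_ge {R : realType} (a b : int -> R) (P : R) v : topple P a b -> a v <= b v.
Proof.
move=> [w [/andP[wP Pw] ->]]; case: ifP => _; last by rewrite addr0.
by rewrite lerDl le_min !subr_ge0 !ltW.
Qed.

(** The integers in the superdifferential of [f] at [P]; two distinct ones witness a kink. *)
Definition supports {R : realType} (alpha beta : R) (f : R -> R) (P : R) (t : int) :=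
  forall z, z \in `[alpha, beta] -> f z <= f P + t%:~R * (z - P).

Definition tent {R : realType} (alpha beta c z : R) : R :=
  Num.min c (Num.min (z - alpha) (beta - z)).

(* Each summand has its peak [min (p i - alpha) (beta - p i)] at [p i], and a kink there. *)
Definition barrier {R : realType} (alpha beta : R) (n : nat) (p : 'I_n -> R) (z : R) : R :=
  \sum_(i < n) tent alpha beta (Num.min (p i - alpha) (beta - p i)) z.

Lemma tent_le {R : realType} (alpha beta c z : R) :
  [/\ tent alpha beta c z <= c, tent alpha beta c z <= z - alpha &
      tent alpha beta c z <= beta - z].
Proof. by rewrite /tent !ge_min !lexx !orbT. Qed.

Lemma supports_tent {R : realType} (alpha beta c P : R) :
  exists t, supports alpha beta (tent alpha beta c) P t.
Proof.
have : [\/ tent alpha beta c P = c, tent alpha beta c P = P - alpha |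
    tent alpha beta c P = beta - P].
  by rewrite /tent; case: leP => _; [constructor 1|case: leP => _; [constructor 2|constructor 3]].
by case=> e; [exists 0|exists 1|exists (- 1)] => z _; rewrite e ?rmorphN /=;
  have [h1 h2 h3] := tent_le alpha beta c z; lra.
Qed.

(** At the peak the constant piece ties with a sloped one. *)
Lemma supports_tent_peak {R : realType} (alpha beta P : R) :
  exists t1 t2, t1 != t2 /\ forall t, t \in [:: t1; t2] ->
    supports alpha beta (tent alpha beta (Num.min (P - alpha) (beta - P))) P t.
Proof.
set c := Num.min _ _; have cP : tent alpha beta c P = c by rewrite /tent -/c minxx.
have : c = P - alpha \/ c = beta - P by rewrite /c; case: leP; [left|right].
by case=> e; [exists 0, 1|exists 0, (- 1)]; split => // t;
  rewrite !inE => /orP[] /eqP -> z _; rewrite cP ?rmorphN /=;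
  have [h1 h2 h3] := tent_le alpha beta c z; rewrite ?mul0r ?addr0 //; lra.
Qed.

Lemma supports_sum {R : realType} (alpha beta P : R) (I : finType) (f : I -> R -> R) (t : I -> int) :
  (forall i, supports alpha beta (f i) P (t i)) ->
  supports alpha beta (fun z => \sum_i f i z) P (\sum_i t i).
Proof.
move=> sf z zin; rewrite rmorph_sum /= mulr_suml -big_split /=.
by apply: ler_sum => i _; exact: sf.
Qed.

Lemma supports_barrier {R : realType} (alpha beta : R) (n : nat) (p : 'I_n -> R) (j : 'I_n) :
  exists t1 t2, t1 != t2 /\ forall t, t \in [:: t1; t2] ->
    supports alpha beta (barrier alpha beta p) (p j) t.
Proof.
have [t1 [t2 [t12 ht]]] := supports_tent_peak alpha beta (p j).
pose f i := tent alpha beta (Num.min (p i - alpha) (beta - p i)).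
have /choice[s hs] : forall i, exists t, supports alpha beta (f i) (p j) t.
  by move=> i; exact: supports_tent.
(* Slopes add up over the summands; only the choice at [j] varies, so the two totals differ. *)
pose s' t i := if i == j then t else s i.
have sumE t : \sum_i s' t i = t + \sum_(i | i != j) s i.
  rewrite (bigD1 j) //= /s' eqxx; congr (_ + _).
  by apply: eq_bigr => i /negbTE ->.
exists (\sum_i s' t1 i), (\sum_i s' t2 i); split.
  by rewrite !sumE (inj_eq (addIr _)).
move=> t; rewrite !inE => /orP[] /eqP ->; apply: (@supports_sum _ _ _ _ _ f) => i;
  rewrite /s'; case: eqVneq => [->|_] //; apply: ht; rewrite !inE eqxx ?orbT //.
Qed.

Section barrier.
Context {R : realType} (alpha beta : R) (n : nat) (p : 'I_n -> R).
Hypotheses (lt_ab : alpha < beta) (p_in : forall i, alpha < p i < beta).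
Local Notation B := (can_coef alpha beta (barrier alpha beta p)).

Lemma barrier_le z : barrier alpha beta p z <= n%:R * (z - alpha) /\
  barrier alpha beta p z <= n%:R * (beta - z).
Proof.
split; rewrite mulr_natl -[n in leRHS]card_ord -sumr_const; apply: ler_sum => i _;
  by have [] := tent_le alpha beta (Num.min (p i - alpha) (beta - p i)) z.
Qed.

Lemma barrier_coef_le v c :
  (forall z, z \in `[alpha, beta] -> barrier alpha beta p z - z * v%:~R <= c) -> B v <= c.
Proof.
move=> le_c; apply: ge_sup; last by move=> _ [z /= zin <-]; exact: le_c.
by exists (barrier alpha beta p alpha - alpha * v%:~R), alpha => //=; rewrite in_itv /= lexx ltW.
Qed.

Lemma barrier_le_coef v z : z \in `[alpha, beta] ->
  barrier alpha beta p z <= B v + z * v%:~R.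
Proof.
move=> zin; rewrite -lerBlDr; apply: ub_le_sup; last by exists z.
(* A crude bound on the barrier plus one on [- (x * v)]: [sup] is meaningful only for a bounded
   set. *)
exists (n%:R * (beta - alpha) + `|v%:~R| * (`|alpha| + `|beta|)) => _ [x /= xin <-].
move: xin; rewrite in_itv /= => /andP[ax xb].
have [h _] := barrier_le x.
have : - (x * v%:~R) <= `|v%:~R| * (`|alpha| + `|beta|).
  apply: le_trans (ler_norm _) _; rewrite normrN normrM mulrC ler_wpM2l //.
  have := ler_norm beta; have := ler_norm (- alpha); rewrite normrN => h1 h2.
  by have := normr_ge0 alpha; have := normr_ge0 beta; rewrite ler_norml; lra.
have : n%:R * (x - alpha) <= n%:R * (beta - alpha) by rewrite ler_wpM2l // lerB.
lra.
Qed.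

(** The barrier lies below [n (z - alpha)], hence below [v (z - alpha)]. This cap equals the initial
    coefficient, so slopes from [n] on stay frozen. *)
Lemma barrier_coef_right (v : int) : n%:Z <= v -> B v <= - alpha * v%:~R.
Proof.
move=> nv; apply: barrier_coef_le => z; rewrite in_itv /= => /andP[az zb].
have [h _] := barrier_le z.
have : 0 <= (v%:~R - n%:R) * (z - alpha).
  by rewrite mulr_ge0 // subr_ge0 // pmulrn ler_int.
lra.
Qed.

Lemma barrier_coef_left (v : int) : v <= - n%:Z -> B v <= - beta * v%:~R.
Proof.
move=> nv; apply: barrier_coef_le => z; rewrite in_itv /= => /andP[az zb].
have [_ h] := barrier_le z.
have : 0 <= (- v%:~R - n%:R) * (beta - z).
  by rewrite mulr_ge0 // subr_ge0 // pmulrn -rmorphN ler_int; lia.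
lra.
Qed.

Lemma barrier_ge0 z : z \in `[alpha, beta] -> 0 <= barrier alpha beta p z.
Proof.
rewrite in_itv /= => /andP[az zb]; apply: sumr_ge0 => i _.
by have /andP[h1 h2] := p_in i; rewrite !le_min !subr_ge0 az zb !ltW.
Qed.

(** A support of slope [t] makes [B t + p j * t] at most the barrier's value at [p j], a lower bound
    for all [B v + p j * v]. *)
Lemma barrier_coef_min (j : 'I_n) (t v : int) :
  supports alpha beta (barrier alpha beta p) (p j) t ->
  B t + p j * t%:~R <= B v + p j * v%:~R.
Proof.
move=> st; have pjin : p j \in `[alpha, beta].
  by have /andP[h1 h2] := p_in j; rewrite in_itv /= !ltW.
apply: le_trans (barrier_le_coef v pjin).
rewrite -lerBrDr; apply: barrier_coef_le => z zin.
by have := st z zin; lra.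
Qed.

End barrier.

(** The canonical coefficients of [zero_series]: initially every particle is at an endpoint. *)
Definition zero_coef {R : realType} (alpha beta : R) (v : int) : R :=
  if 0 <= v then - alpha * v%:~R else - beta * v%:~R.

Lemma kink_zero_coef {R : realType} (alpha beta : R) (v : int) :
  kink (zero_coef alpha beta) v = if 1 <= v then alpha else beta.
Proof.
rewrite /kink /zero_coef; have -> : (0 <= v - 1) = (1 <= v) by lia.
case: ifP => h1; first by rewrite ifT ?rmorphB /=; [ring | lia].
case: ifP => h2; last by rewrite rmorphB /=; ring.
have -> : v = 0 by lia.
by rewrite sub0r rmorphN /=; ring.
Qed.

Lemma zero_coef_tame {R : realType} (alpha beta : R) :
  alpha < beta -> tame alpha beta (zero_coef alpha beta).
Proof.
move=> lt_ab; split.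
  move=> v; rewrite !kink_zero_coef; case: ifP => h; case: ifP => h'; rewrite ?lexx ?ltW //; lia.
exists 0%N; split => v hv; rewrite /zero_coef.
  by rewrite ifT.
case: ifP => // v0; have -> : v = 0 by lia.
by rewrite !mulr0.
Qed.

Lemma trop_zero_coef {R : realType} (alpha beta z : R) :
  alpha < beta -> z \in `[alpha, beta] -> trop (zero_coef alpha beta) z = 0.
Proof.
move=> lt_ab; rewrite in_itv /= => /andP[az zb].
have [sa _] := zero_coef_tame lt_ab.
rewrite (@trop_active _ _ 0) //; first by rewrite /zero_coef lexx !mulr0 addr0.
by rewrite !kink_zero_coef az.
Qed.

(** * Finitely many moves *)

(* Only [y 0, ..., y M] are recorded; the index increases from left to right,
   opposite to the slopes. *)
Definition gap_move {R : realType} (M : nat) (P : R) (y y' : nat -> R) :=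
  exists i, [/\ (i < M)%N, y i < P < y i.+1 &
    let c := Num.min (P - y i) (y i.+1 - P) in
    [/\ y' i = y i + c, y' i.+1 = y i.+1 - c &
        forall j, j != i -> j != i.+1 -> y' j = y j]].

(** A negative charge travels right, with positions [i..M] to count; a positive one travels left,
    with [0..i]. Counting [i] itself makes every charge cost at least one. *)
Definition charge_weight {R : realType} (M i : nat) (e : R) : nat :=
  (if (e < 0)%R then M.+1 - i else if (0 < e)%R then i.+1 else 0)%N.

(* Particles whose limit is none of the [p j] carry no charge: a charge passed to
   such a particle is lost, which only helps. *)
Definition pinned_weight {R : realType} {n : nat} (p : 'I_n -> R) (M : nat)
    (l y : nat -> R) (i : nat) : nat :=
  if [exists j, p j == l i] then charge_weight M i (y i - l i) else 0%N.

Lemma sum_pair_lt (f g : nat -> nat) (M i : nat) :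
  (i < M)%N ->
  (forall j, j != i -> j != i.+1 -> f j = g j) ->
  (f i + f i.+1 < g i + g i.+1)%N ->
  (\sum_(j < M.+1) f j < \sum_(j < M.+1) g j)%N.
Proof.
move=> iM fg lt_fg.
have iM1 : (i < M.+1)%N by lia.
have nei : Ordinal (n := M.+1) (m := i.+1) iM != Ordinal iM1.
  by rewrite -val_eqE /=; lia.
rewrite (bigD1 (Ordinal iM1)) //= (bigD1 (Ordinal (n := M.+1) (m := i.+1) iM)) //=.
rewrite [X in (_ < X)%N](bigD1 (Ordinal iM1)) //=.
rewrite [X in (_ < _ + X)%N](bigD1 (Ordinal (n := M.+1) (m := i.+1) iM)) //=.
rewrite !addnA (eq_bigr (fun j : 'I_M.+1 => g j)) ?ltn_add2r // => j /andP[j1 j2].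
by apply: fg.
Qed.

(** A negative merged charge weighs one less than [e] did at [i]; a positive one has the weight [d]
    already had. *)
Lemma charge_weight_shift_right {R : realType} (M i : nat) (e d : R) :
  (i < M)%N -> e < 0 ->
  (charge_weight M i.+1 (d + e) < charge_weight M i e + charge_weight M i.+1 d)%N.
Proof.
move=> iM e0; rewrite /charge_weight e0.
case: (ltgtP d 0) => hd; case: (ltgtP (d + e) 0) => hs; try lia; exfalso; lra.
Qed.

Lemma charge_weight_shift_left {R : realType} (M i : nat) (e d : R) :
  (i < M)%N -> 0 < e ->
  (charge_weight M i (d + e) < charge_weight M i d + charge_weight M i.+1 e)%N.
Proof.
move=> iM e0; rewrite /charge_weight e0 (lt_gtF e0).
case: (ltgtP d 0) => hd; case: (ltgtP (d + e) 0) => hs; try lia; exfalso; lra.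
Qed.

Lemma charge_weight_cancel {R : realType} (M i : nat) (e d : R) :
  (i < M)%N -> e < 0 -> 0 < d ->
  let c := Num.min (- e) d in
  (charge_weight M i (e + c) + charge_weight M i.+1 (d - c) <
   charge_weight M i e + charge_weight M i.+1 d)%N.
Proof.
move=> iM e0 d0 /=; rewrite /charge_weight e0 d0 (lt_gtF d0).
by case: (leP (- e) d) => h; 
 case: (ltgtP (e + _) 0) => h1; case: (ltgtP (d - _) 0) => h2; try lia; exfalso; lra.
Qed.

Lemma gap_move_weight {R : realType} (n : nat) (p : 'I_n -> R) (M : nat)
    (l y y' : nat -> R) (e : R) (j : 'I_n) :
  (forall i (k : 'I_n), (i <= M)%N -> p k != l i -> 4 * e <= `|l i - p k|) ->
  (forall i, (i <= M)%N -> `|y i - l i| < e) ->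
  (forall i, (i <= M)%N -> `|y' i - l i| < e) ->
  gap_move M (p j) y y' ->
  (\sum_(i < M.+1) pinned_weight p M l y' i <
   \sum_(i < M.+1) pinned_weight p M l y i)%N.
Proof.
move=> sep near_y near_y' [i [iM /andP[yip pyi] [y'i y'i1 y'j]]].
have iM1 : (i <= M)%N by exact: ltnW.
apply: (sum_pair_lt iM) => [k k1 k2|]; first by rewrite /pinned_weight y'j.
have pin k : p j = l k -> [exists j0, p j0 == l k].
  by move=> pl; apply/existsP; exists j; apply/eqP.
have := near_y _ iM1; have := near_y _ iM.
have := near_y' _ iM1; have := near_y' _ iM.
rewrite y'i y'i1 /pinned_weight y'i y'i1 !ltr_norml.
move=> /andP[ya ya'] /andP[yb yb'] /andP[yc yc'] /andP[yd yd'].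
clear y'i y'i1 y'j near_y near_y'.
(* Cases by which of the two moving particles has limit [p j]. If both do, their charges are
   opposite and cancel. *)
have [pl|pl] := eqVneq (p j) (l i); have [pl1|pl1] := eqVneq (p j) (l i.+1).
- rewrite !pin // -pl -pl1.
  rewrite addrAC (addrAC (y i.+1)) -[p j - y i]opprB.
  by apply: charge_weight_cancel => //; rewrite ?subr_lt0 ?subr_gt0.
(* The right particle is too far from [p j] to arrive first, so the left one lands on its limit and
   passes its whole charge to the right. *)
- have := sep _ j iM pl1; rewrite ler_normr => /orP s.
  have -> : Num.min (p j - y i) (y i.+1 - p j) = p j - y i.
    by apply/min_idPl; case: s => s; lra.
  rewrite pin // -pl.
  have -> : y i + (p j - y i) - p j = 0 by lra.
  rewrite {1}/charge_weight ltxx add0n.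
  have ei : y i - p j < 0 by lra.
  case: ifP => _; last by rewrite addn0 /charge_weight ei subn_gt0 ltnS.
  have -> : y i.+1 - (p j - y i) - l i.+1 = y i.+1 - l i.+1 + (y i - p j) by lra.
  exact: charge_weight_shift_right.
- have := sep _ j iM1 pl; rewrite ler_normr => /orP s.
  have -> : Num.min (p j - y i) (y i.+1 - p j) = y i.+1 - p j.
    by apply/min_idPr; case: s => s; lra.
  rewrite (pin _ pl1) // -pl1.
  have -> : y i.+1 - (y i.+1 - p j) - p j = 0 by lra.
  rewrite [X in (_ + X < _)%N]/charge_weight ltxx addn0.
  have ei : 0 < y i.+1 - p j by lra.
  case: ifP => _; last by rewrite add0n /charge_weight ei (lt_gtF ei).
  have -> : y i + (y i.+1 - p j) - l i = y i - l i + (y i.+1 - p j) by lra.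
  exact: charge_weight_shift_left.
(* The move puts one particle exactly on [p j], within [e] of a limit that is at least [4 * e]
   away. *)
- exfalso.
  have := sep _ j iM1 pl; have := sep _ j iM pl1; rewrite !ler_normr => /orP s1 /orP s2.
  clear sep pin; move: ya ya' yb yb'; case: (leP (p j - y i)) => h ya ya' yb yb';
    case: s1 => s1; case: s2 => s2; lra.
Qed.

Lemma eventually_no_descent (mv : nat -> Prop) (Phi : nat -> nat) (T : nat) :
  (forall t, (T <= t)%N -> (Phi t.+1 <= Phi t)%N) ->
  (forall t, (T <= t)%N -> mv t -> (Phi t.+1 < Phi t)%N) ->
  exists T', forall t, (T' <= t)%N -> ~ mv t.
Proof.
move=> noninc dec.
have mono t u : (T <= t)%N -> (Phi (t + u) <= Phi t)%N.
  move=> Tt; elim: u => [|u IH]; first by rewrite addn0.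
  by rewrite addnS (leq_trans (noninc _ _)) //; lia.
(* Induction on a bound [c] for the current value of [Phi]: each move lowers it. *)
suff H : forall c t0, (T <= t0)%N -> (Phi t0 <= c)%N ->
    exists T', forall t, (T' <= t)%N -> ~ mv t by exact: (H (Phi T) T).
elim=> [|c IH] t0 Tt0 le_c.
  exists t0 => t tt /dec; rewrite -(subnKC tt) => d.
  have := mono t0 (t - t0)%N Tt0; have := d ltac:(lia); lia.
have [[t [tt mt]]|none] := pselect (exists t, (t0 <= t)%N /\ mv t).
  apply: (IH t.+1); first lia.
  have := dec t ltac:(lia) mt; have := mono t0 (t - t0)%N Tt0; rewrite subnKC //; lia.
by exists t0 => t tt mt; apply: none; exists t.
Qed.

Lemma finitely_many_gap_moves {R : realType} (n : nat) (p : 'I_n -> R)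
    (k : nat -> 'I_n) (M : nat) (y : nat -> nat -> R) :
  (forall i, cvgn (fun t => y t i)) ->
  (forall t, y t.+1 =1 y t \/ gap_move M (p (k t)) (y t) (y t.+1)) ->
  exists T, forall t, (T <= t)%N -> ~ gap_move M (p (k t)) (y t) (y t.+1).
Proof.
move=> ycvg ystep.
pose l i := limn (fun t => y t i).
(* There are finitely many pairs of a limit and a point, so one [e] separates all the distinct
   ones. *)
have [e [e0 sep]] : exists e : R, 0 < e /\ forall (i : 'I_M.+1) (j : 'I_n),
    p j != l i -> 4 * e <= `|l i - p j|.
  have : \forall e \near 0^'+, forall (i : 'I_M.+1) (j : 'I_n),
    p j != l i -> 4 * e <= `|l i - p j|.
    apply: filter_forall => i; apply: filter_forall => j.
    have [pl|pl] := eqVneq (p j) (l i); first by near=> e.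
    have d0 : 0 < `|l i - p j| / 4 by rewrite divr_gt0 // normr_gt0 subr_eq0 eq_sym.
    near=> e => _; rewrite mulrC -ler_pdivlMr //.
    by near: e; exact: nbhs_right_le.
  move=> H; have [e [He e0]] := filter_ex (filterI H (nbhs_right_gt (0:R))).
  by exists e.
have : \forall t \near \oo, forall i : 'I_M.+1, `|y t i - l i| < e.
  apply: filter_forall => i.
  by have /cvgrPdistC_lt := ycvg i; apply.
move=> [T _ nearT].
have {}nearT t i : (T <= t)%N -> (i <= M)%N -> `|y t i - l i| < e.
  by move=> Tt iM; exact: (nearT t Tt (Ordinal (n := M.+1) iM)).
have {}sep i (j : 'I_n) : (i <= M)%N -> p j != l i -> 4 * e <= `|l i - p j|.
  by move=> iM; exact: (sep (Ordinal (n := M.+1) iM)).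
pose Phi t := (\sum_(i < M.+1) pinned_weight p M l (y t) i)%N.
have dec t : (T <= t)%N -> gap_move M (p (k t)) (y t) (y t.+1) ->
    (Phi t.+1 < Phi t)%N.
  move=> Tt; apply: gap_move_weight sep _ _ => i; first exact: nearT.
  by apply: nearT; lia.
apply: (@eventually_no_descent _ Phi T) => // t Tt.
case: (ystep t) => [ey|]; last by move/(dec _ Tt)/ltnW.
by rewrite leq_eqVlt (_ : Phi t.+1 = Phi t) ?eqxx //; apply: eq_bigr => i _;
  rewrite /pinned_weight ey.
Unshelve. all: by end_near.
Qed.

(** Positions [0..2n+1] list the kinks from [n + 1] down to [- n], with the extreme ones at the
    endpoints. Beyond this range both kinks of a slope coincide and cannot enclose [P]. *)
Lemma topple_gap_move {R : realType} (alpha beta P : R) (a b : int -> R) (n : nat) :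
  (forall v : int, n%:Z < v -> kink a v = alpha) ->
  (forall v : int, v <= - n%:Z -> kink a v = beta) ->
  topple P a b ->
  gap_move n.*2.+1 P (fun i => kink a (n.+1%:Z - i%:Z)) (fun i => kink b (n.+1%:Z - i%:Z)).
Proof.
move=> ka kb [w [/andP[wP Pw] hb]].
have wn : w <= n%:Z.
  by rewrite leNgt; apply/negP => h; move: wP Pw; rewrite !ka; [lra|lia..].
have nw : - n%:Z <= w.
  by rewrite leNgt; apply/negP => h; move: wP Pw; rewrite !kb; [lra|lia..].
exists `|n%:Z - w|%N.
have -> : n.+1%:Z - `|n%:Z - w|%N%:Z = w + 1 by lia.
have -> : n.+1%:Z - (`|n%:Z - w|%N.+1)%:Z = w by lia.
split; [lia|by rewrite wP|split].
- rewrite [kink b _]/kink !hb !addrK eqxx ifF; last lia.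
  by move: (Num.min _ _) => c; rewrite addr0 [in RHS]/kink addrK; ring.
- rewrite [kink b _]/kink !hb eqxx ifF; last lia.
  by move: (Num.min _ _) => c; rewrite addr0 [in RHS]/kink; ring.
move=> j jw jw1; rewrite [kink b _]/kink !hb !ifF; [by rewrite !addr0|lia..].
Qed.

(** * Stabilization of the relaxation *)

Theorem mainTheorem1 (R : realType) (alpha beta : R) (n : nat)
    (p : 'I_n -> R) (k : nat -> 'I_n) :
  alpha < beta ->
  (forall i, alpha < p i < beta) ->
  (forall (i : 'I_n) (N : nat), exists m, (N <= m)%N /\ k m = i) ->
  exists m0 : nat, (1 <= m0)%N /\ forall m : nat, (m0 <= m)%N ->
    forall z, z \in `[alpha, beta] ->
      relax alpha beta p k m z = relax alpha beta p k m0 z.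
Proof.
move=> lt_ab p_in _.
pose F := relax alpha beta p k; pose A t := can_coef alpha beta (F t).
have F0 z : z \in `[alpha, beta] -> F 0%N z = trop (zero_coef alpha beta) z.
  by move=> zin; rewrite trop_zero_coef.
have A0 : A 0%N = zero_coef alpha beta := can_coef_trop (zero_coef_tame lt_ab) F0.
have step t : tame alpha beta (A t) ->
    (forall z, z \in `[alpha, beta] -> F t z = trop (A t) z) ->
    [/\ tame alpha beta (A t.+1), A t.+1 = A t \/ topple (p (k t)) (A t) (A t.+1) &
      forall z, z \in `[alpha, beta] -> F t.+1 z = trop (A t.+1) z].
  move=> tA FA; have [b [tb sb Fb]] := Gop_step (p_in (k t)) tA FA.
  by rewrite [A t.+1](can_coef_trop tb Fb).
have inv t : tame alpha beta (A t) /\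
    forall z, z \in `[alpha, beta] -> F t z = trop (A t) z.
  elim: t => [|t [tA FA]]; last by have [] := step t tA FA.
  by rewrite A0; split => //; exact: zero_coef_tame.
have {}step t : A t.+1 = A t \/ topple (p (k t)) (A t) (A t.+1).
  by have [tA FA] := inv t; have [] := step t tA FA.
pose B := can_coef alpha beta (barrier alpha beta p).
have mono v : nondecreasing_seq (A ^~ v).
  apply/nondecreasing_seqP => t; case: (step t) => [->//|]; exact: topple_ge.
have leB t v : A t v <= B v.
  elim: t v => [|t IH] v.
    rewrite A0 /zero_coef.
    have alin : alpha \in `[alpha, beta] by rewrite in_itv /= lexx ltW.
    have bein : beta \in `[alpha, beta] by rewrite in_itv /= lexx ltW.
    have := barrier_le_coef p v alin; have := barrier_ge0 p_in alin.
    have := barrier_le_coef p v bein; have := barrier_ge0 p_in bein.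
    by rewrite -/B; case: ifP => _; lra.
  case: (step t) => [->//|tp].
  have [t1 [t2 [t12 ht]]] := supports_barrier alpha beta p (k t).
  have [[sA _] _] := inv t.
  apply: (topple_le_barrier sA tp IH t12) => u; apply: barrier_coef_min => //;
    by apply: ht; rewrite !inE eqxx ?orbT.
have ge0 t v : zero_coef alpha beta v <= A t v by rewrite -A0; exact: (mono v 0%N t).
(* The coefficient is squeezed between its initial value and the barrier's, which is no larger for
   these slopes. *)
have Ar t (v : int) : n%:Z <= v -> A t v = - alpha * v%:~R.
  move=> nv; apply/le_anti; rewrite (le_trans (leB t v)) ?barrier_coef_right //=.
  by apply: le_trans (ge0 t v); rewrite /zero_coef ifT //; lia.
have Al t (v : int) : v <= - n%:Z -> A t v = - beta * v%:~R.
  move=> nv; apply/le_anti; rewrite (le_trans (leB t v)) ?barrier_coef_left //=.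
  apply: le_trans (ge0 t v); rewrite /zero_coef; case: ifP => // v0.
  have -> : v = 0 by lia.
  by rewrite !mulr0.
have kr t (v : int) : n%:Z < v -> kink (A t) v = alpha.
  by move=> nv; rewrite /kink !Ar ?rmorphB /=; [ring|lia..].
have kl t (v : int) : v <= - n%:Z -> kink (A t) v = beta.
  by move=> nv; rewrite /kink !Al ?rmorphB /=; [ring|lia..].
pose y t i := kink (A t) (n.+1%:Z - i%:Z).
have Acvg v : cvgn (A ^~ v).
  apply: nondecreasing_is_cvgn => //; exists (B v) => _ [t _ <-]; exact: leB.
have ycvg i : cvgn (fun t => y t i) by apply: is_cvgB; exact: Acvg.
have [|T noT] := @finitely_many_gap_moves _ _ p k n.*2.+1 y ycvg.
  move=> t; case: (step t) => [e|tp]; first by left => i; rewrite /y e.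
  by right; exact: (topple_gap_move (kr t) (kl t) tp).
have stay t : (T <= t)%N -> A t.+1 = A t.
  move=> /noT nm; case: (step t) => // tp; case: nm.
  exact: (topple_gap_move (kr t) (kl t) tp).
(* The successor ensures [1 <= m0]. *)
exists T.+1; split => // m Tm z zin.
rewrite -/(F m) -/(F T.+1) !(proj2 (inv _)) //.
suff -> : A m = A T.+1 by [].
by rewrite -(subnKC Tm); elim: (m - T.+1)%N => [|j IH]; rewrite ?addn0 // addnS stay //; lia.
Qed.
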